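(* For $n$ large, there exists a family of $2^{\lfloor n/13\rfloor}$ non-isomorphic, mutually cospectral graphs with respect to the matrix $\mathrm{Adj}+tD$ ($t$ arbitrary).
   Context: All graphs are finite, simple and undirected. $\mathrm{Adj}$ denotes the adjacency matrix of a graph and $D$ its diagonal matrix of degrees; $t$ is an arbitrary real number, and the same family of graphs serves for all $t$. Graphs are mutually cospectral with respect to a matrix if the associated matrices all have the same eigenvalues with the same multiplicities. ''Non-isomorphic'' means pairwise non-isomorphic. *)

(* Defs.v *)
From HB Require Import structures.
From mathcomp Require Import all_boot all_order all_algebra all_fingroup reals.

Set Implicit Arguments.
Unset Strict Implicit.
Unset Printing Implicit Defensive.

Import GRing.Theory.
Local Open Scope ring_scope.

Record sgraph (n : nat) := SGraph {
  adj :> rel 'I_n;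
  adj_sym : symmetric adj;
  adj_irrefl : irreflexive adj
}.

Definition isomorphic (n : nat) (G H : sgraph n) : Prop :=
  exists s : {perm 'I_n}, forall u v : 'I_n, adj H (s u) (s v) = adj G u v.

Definition degree (n : nat) (G : sgraph n) (u : 'I_n) : nat :=
  #|[set v | adj G u v]|.

Definition adjmx (R : pzSemiRingType) (n : nat) (G : sgraph n) : 'M[R]_n :=
  \matrix_(u, v) (adj G u v)%:R.

Definition degmx (R : pzSemiRingType) (n : nat) (G : sgraph n) : 'M[R]_n :=
  diag_mx (\row_u (degree G u)%:R).

(* [mup a (char_poly A)] is the algebraic multiplicity of [a] as an eigenvalue
   of [A], being 0 when [a] is not an eigenvalue. Only the eigenvalues lying in
   [R] are compared; for symmetric matrices over the reals these are all of
   them. *)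
Definition cospectral (R : realType) (n : nat) (A B : 'M[R]_n) : Prop :=
  forall a : R, mup a (char_poly A) = mup a (char_poly B).

(* Main.v *)
(* Take n %/ 13 gadgets on 11 vertices each, and leave the other vertices
   isolated. A gadget has four independent vertices c0, ..., c3, a triangle
   p1, p2, p3, three vertices q1, q2, q3, and a spine vertex. In one state p_i
   is joined to c0 and c_i, and q_i to the other two c's; in the other state
   these neighbourhoods are complemented in {c0, ..., c3}. The spine vertex of
   gadget h is joined to all the c's of every gadget g >= h, so that the c's of
   gadget g have degree g + 4. Toggling a gadget is a Godsil-McKay switching at
   its c's which preserves all degrees, so it conjugates Adj and D
   simultaneously. The states can be read off the isomorphism class: the only
   4-cliques are {c0, p1, p2, p3} in the gadgets in the first state, and the
   degree sum 16 + g of such a clique reveals the gadget. *)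
Require Import Defs.
From HB Require Import structures.
From mathcomp Require Import all_boot all_order all_algebra all_fingroup reals.
From mathcomp Require Import ring.

Set Implicit Arguments.
Unset Strict Implicit.
Unset Printing Implicit Defensive.

Import GRing.Theory.
Local Open Scope ring_scope.

(** * Tools: an isomorphism invariant and equality of characteristic polynomials *)

Lemma isomorphic_sym (n : nat) (G H : sgraph n) :
  isomorphic G H -> isomorphic H G.
Proof.
by case=> s sE; exists s^-1%g => u v; rewrite -sE !permKV.
Qed.

Lemma degree_perm (n : nat) (G H : sgraph n) (s : {perm 'I_n}) (u : 'I_n) :
  (forall u v : 'I_n, adj H (s u) (s v) = adj G u v) ->
  degree H (s u) = degree G u.
Proof.
move=> sE; rewrite /degree -(card_imset [set v | adj G u v] (@perm_inj _ s)).
congr #|pred_of_set _|; apply/setP=> v; rewrite inE -[v in LHS](permKV s) sE.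
by rewrite -{2}[v](permKV s) mem_imset ?inE //; apply: perm_inj.
Qed.

Definition clique4 (T : Type) (r : rel T) (u1 u2 u3 u4 : T) : bool :=
  [&& r u1 u2, r u1 u3, r u1 u4, r u2 u3, r u2 u4 & r u3 u4].

Definition has_clique4_of_degree_sum (n : nat) (G : sgraph n) (d : nat) : Prop :=
  exists u1 u2 u3 u4 : 'I_n, clique4 (adj G) u1 u2 u3 u4 /\
    (degree G u1 + degree G u2 + degree G u3 + degree G u4)%N = d.

Lemma isomorphic_has_clique4 (n : nat) (G H : sgraph n) (d : nat) :
  isomorphic G H ->
  has_clique4_of_degree_sum G d -> has_clique4_of_degree_sum H d.
Proof.
case=> s sE [u1 [u2 [u3 [u4 [K dE]]]]]; exists (s u1), (s u2), (s u3), (s u4).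
by rewrite /clique4 !sE !(degree_perm _ sE).
Qed.

Lemma char_poly_intertwine (R : idomainType) (n : nat) (Q A B : 'M[R]_n) :
  \det Q != 0 -> Q *m A = B *m Q -> char_poly A = char_poly B.
Proof.
move=> Q0 QAB; have QP0 : \det (map_mx polyC Q) != 0 by rewrite det_map_mx polyC_eq0.
(* Instead of inverting [Q], cancel its nonzero determinant, as a constant polynomial, from [\det Q
   * \det (X - A) = \det (X - B) * \det Q]. *)
apply: (mulfI QP0); rewrite [RHS]mulrC -!det_mulmx; congr (\det _).
rewrite /char_poly_mx mulmxBr mulmxBl -!map_mxM QAB.
by rewrite mul_mx_scalar mul_scalar_mx.
Qed.

(** * Finite checks on the labels of one gadget *)

Lemma big_ord11 (V : Type) (op : V -> V -> V) (x : V) (F : nat -> V) :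
  \big[op/x]_(i < 11) F i = foldr (fun i s => op (F i) s) x (iota 0 11).
Proof. by rewrite -(big_mkord xpredT F) unlock. Qed.

(** With [P] on [nat] and the explicit list [iota 0 11], the premise is a closed term that
    [vm_compute] can evaluate. *)
Lemma ord11P (P : pred nat) : all P (iota 0 11) -> forall a : 'I_11, P a.
Proof. by move=> /allP P11 a; apply: P11; rewrite mem_iota /=. Qed.

Lemma ord11P2 (P : rel nat) :
  all (fun a => all (P a) (iota 0 11)) (iota 0 11) -> forall a b : 'I_11, P a b.
Proof.
by move=> P11 a; apply: ord11P (P a) (@ord11P (fun a => all (P a) (iota 0 11)) P11 a).
Qed.

(* Labels in a gadget: 0-3 are the c's, 4-6 the p's, 7-9 the q's, and 10 is the
   spine vertex. The boolean [x] is the state. *)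
Definition crossing (x : bool) (a b : nat) : bool :=
  [&& a < 4, 4 <= b & b < 10]%N &&
  ((a == 0%N) || (a == ((b - 4) %% 3).+1) (+) (7 <= b)%N (+) x).

Definition gadget (x : bool) (a b : nat) : bool :=
  [|| [&& 4 <= a, a < 7, 4 <= b, b < 7 & a != b]%N,
      crossing x a b | crossing x b a].

Definition spine (a b : nat) : bool := (a < 4)%N && (b == 10%N).

(* Adjacency of labels [a] and [b] in gadgets [g] and [h], where [e] stands for
   [g == h], [l] for [h <= g] and [l'] for [g <= h]; [x] matters only if [e]. *)
Definition label_adj (e x l l' : bool) (a b : nat) : bool :=
  [|| e && gadget x a b, spine a b && l | spine b a && l'].

Lemma label_adj_sym (e x l l' : bool) (a b : 'I_11) :
  label_adj e x l l' a b = label_adj e x l' l b a.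
Proof.
apply/eqP; move: a b.
apply: (@ord11P2 (fun a b => label_adj e x l l' a b == label_adj e x l' l b a)).
by case: e x l l' => -[] [] []; vm_compute.
Qed.

Lemma label_adj_irrefl (e x l l' : bool) (a : 'I_11) :
  label_adj e x l l' a a = false.
Proof.
apply/negbTE; move: a.
apply: (@ord11P (fun a => ~~ label_adj e x l l' a a)).
by case: e x l l' => -[] [] []; vm_compute.
Qed.

(** Spine edges are left out. The state is irrelevant since each p or q sees two of the four c's,
    and each c sees three of the six p's and q's. *)
Definition base_degree (a : nat) : nat :=
  if (a < 4)%N then 3 else if (a < 7)%N then 4 else if (a < 10)%N then 2 else 0.

Lemma sum_label_adj (e x l l' : bool) (a : 'I_11) :
  (\sum_(b < 11) label_adj e x l l' a b =
   e * base_degree a + (a < 4) * l + (a == 10 :> nat) * (4 * l'))%N.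
Proof.
rewrite (big_ord11 _ _ (fun b => label_adj e x l l' a b : nat)).
apply/eqP; move: a.
pose s a := foldr (fun b s => label_adj e x l l' a b + s)%N 0%N (iota 0 11).
apply: (@ord11P (fun a => s a ==
  e * base_degree a + (a < 4) * l + (a == 10) * (4 * l'))%N); rewrite /s {s}.
by case: e x l l' => -[] [] []; vm_compute.
Qed.

(* Twice the Godsil-McKay matrix: [J - 2I] on the c's of a switched gadget and
   [2I] elsewhere. The factor 2 keeps the entries integral. *)
Definition sw (d : bool) (a b : nat) : int :=
  if [&& d, a < 4 & b < 4]%N then 1 - (a == b)%:R *+ 2 else (a == b)%:R *+ 2.

Lemma sw_sym (d : bool) (a b : nat) : sw d a b = sw d b a.
Proof. by rewrite /sw [b == a]eq_sym; case: d => //=; rewrite andbC. Qed.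

(** On the four switched c's, [J^2 = 4J] gives [(J - 2I)^2 = 4J - 4J + 4I = 4I]. *)
Lemma sw_sqr (d : bool) (a b : 'I_11) :
  \sum_(c < 11) sw d a c * sw d c b = (a == b)%:R *+ 4.
Proof.
rewrite (big_ord11 _ _ (fun c => sw d a c * sw d c b)) -val_eqE /=.
apply/eqP; move: a b.
pose s a b := foldr (fun c s => sw d a c * sw d c b + s) 0 (iota 0 11).
apply: (@ord11P2 (fun a b => s a b == (a == b)%:R *+ 4)); rewrite /s {s}.
by case: d; vm_compute.
Qed.

(* When [e] fails, [d] belongs to the gadget of [b] and is unrelated to the
   gadget of [a]. *)
Lemma sw_label_adj (e x x' l l' d : bool) (a b : 'I_11) :
  (e -> d = x (+) x') ->
  \sum_(c < 11) sw (x (+) x') a c * (label_adj e x l l' c b)%:R =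
  \sum_(c < 11) (label_adj e x' l l' a c)%:R * sw d c b.
Proof.
move=> ed.
rewrite (big_ord11 _ _ (fun c => sw (x (+) x') a c * (label_adj e x l l' c b)%:R)).
rewrite (big_ord11 _ _ (fun c => (label_adj e x' l l' a c)%:R * sw d c b)).
apply/eqP; move: a b.
pose s a b := foldr
  (fun c s => sw (x (+) x') a c * (label_adj e x l l' c b)%:R + s) 0 (iota 0 11).
pose s' a b := foldr
  (fun c s => (label_adj e x' l l' a c)%:R * sw d c b + s) 0 (iota 0 11).
apply: (@ord11P2 (fun a b => s a b == s' a b)); rewrite /s /s' {s s'}.
case: e ed => [/(_ isT)->|_]; first by case: x x' l l' => -[] [] []; vm_compute.
by case: x x' l l' d => -[] [] [] []; vm_compute.
Qed.

(** An upper bound for [label_adj] over all states and pairs of gadgets, so that one computation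
    treats cliques that might spread over several gadgets. *)
Definition coarse_adj (a b : nat) : bool :=
  [|| gadget false a b, gadget true a b, spine a b | spine b a].

Lemma label_adj_coarse (e x l l' : bool) (a b : nat) :
  label_adj e x l l' a b -> coarse_adj a b.
Proof.
rewrite /coarse_adj.
by case/or3P=> /andP[+ +]; [case: x => _ -> | move=> -> | move=> ->];
  rewrite ?orbT.
Qed.

Lemma ord11P4 (P : nat -> nat -> nat -> nat -> bool) :
  all (fun a => all (fun b => all (fun c => all (P a b c)
    (iota 0 11)) (iota 0 11)) (iota 0 11)) (iota 0 11) ->
  forall a b c d : 'I_11, P a b c d.
Proof.
move=> P11 a b; apply: (@ord11P2 (P a b)); move: a b.
by apply: (@ord11P2 (fun a b => all (fun c => all (P a b c) (iota 0 11)) (iota 0 11))).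
Qed.

(** A spine vertex has only c's as neighbours and no two c's are adjacent, so it lies in no
    triangle. *)
Lemma coarse_clique4 (a b c d : 'I_11) : clique4 coarse_adj a b c d ->
  [&& a != 10%N :> nat, b != 10%N :> nat, c != 10%N :> nat & d != 10%N :> nat].
Proof.
apply/implyP; move: a b c d.
apply: (@ord11P4 (fun a b c d => clique4 coarse_adj a b c d ==>
  [&& a != 10, b != 10, c != 10 & d != 10]%N)).
by vm_compute.
Qed.

(** The q's lie in no triangle and the c's are independent, so a 4-clique is one c with the three
    p's. Only c0 in the first state sees all three p's; the base degrees are then 3, 4, 4, 4. *)
Lemma gadget_clique4 (x : bool) (a b c d : 'I_11) :
  clique4 (gadget x) a b c d ->
  [&& ~~ x, base_degree a + base_degree b + base_degree c + base_degree d == 15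
    & (a < 4) + (b < 4) + (c < 4) + (d < 4) == 1]%N.
Proof.
apply/implyP; move: a b c d.
apply: (@ord11P4 (fun a b c d => clique4 (gadget x) a b c d ==>
  [&& ~~ x, base_degree a + base_degree b + base_degree c + base_degree d == 15
    & (a < 4) + (b < 4) + (c < 4) + (d < 4) == 1]%N)).
by case: x; vm_compute.
Qed.

(** * The whole graph and its degrees *)

Definition vertex (k m : nat) : Type := ('I_k * 'I_11 + 'I_m)%type.

Definition vadj (k m : nat) (x : 'I_k -> bool) : rel (vertex k m) :=
  fun u v => match u, v with
  | inl (g, a), inl (h, b) => label_adj (g == h) (x g) (h <= g)%N (g <= h)%N a b
  | _, _ => false
  end.

Lemma vadj_sym (k m : nat) (x : 'I_k -> bool) : symmetric (@vadj k m x).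
Proof.
move=> [[g a]|i] [[h b]|j] //=; rewrite label_adj_sym eq_sym.
by case: eqVneq => [->|].
Qed.

Lemma vadj_irrefl (k m : nat) (x : 'I_k -> bool) : irreflexive (@vadj k m x).
Proof. by move=> [[g a]|i] //=; rewrite label_adj_irrefl. Qed.

Lemma big_vertex (V : Type) (idx : V) (op : Monoid.com_law idx) (k m : nat)
    (F : 'I_k * 'I_11 + 'I_m -> V) :
  \big[op/idx]_w F w =
  op (\big[op/idx]_(h < k) \big[op/idx]_(b < 11) F (inl (h, b)))
     (\big[op/idx]_(i < m) F (inr i)).
Proof.
rewrite big_sumType /=; congr (op _ _).
by rewrite (pair_bigA _ (fun h b => F (inl (h, b)))); apply: eq_bigr => -[].
Qed.

Definition vdegree (k m : nat) (u : vertex k m) : nat :=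
  match u with
  | inl (g, a) => (base_degree a + (a < 4) * g.+1 +
      (a == 10 :> nat) * (4 * \sum_(h < k) (g <= h)))%N
  | inr _ => 0%N
  end.

Lemma sum_leq_ord (k : nat) (g : 'I_k) : (\sum_(h < k) (h <= g) = g.+1)%N.
Proof.
rewrite -[RHS]card_ord -sum1_card (big_ord_widen k (fun=> 1%N)) //.
by rewrite [RHS]big_mkcond; apply: eq_bigr => h _; rewrite ltnS; case: (h <= g)%N.
Qed.

Lemma sum_vadj (k m : nat) (x : 'I_k -> bool) (u : 'I_k * 'I_11 + 'I_m) :
  (\sum_w vadj x u w)%N = vdegree u.
Proof.
rewrite big_vertex; case: u => [[g a]|i] /=; last first.
  by rewrite !big1 // => h _; rewrite big1.
rewrite [X in (_ + X)%N]big1 // addn0.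
under eq_bigr => h _ do rewrite sum_label_adj.
rewrite !big_split /= -!big_distrr /= -!big_distrl /=.
rewrite (bigD1 g) //= eqxx big1 ?addn0 ?mul1n => [|h /negbTE]; last first.
  by rewrite eq_sym => ->.
by congr (_ + _ * _ + _)%N; apply: sum_leq_ord.
Qed.

(** * The block-diagonal switching matrix *)

Definition vsw (k m : nat) (d : 'I_k -> bool) (u v : vertex k m) : int :=
  match u, v with
  | inl (g, a), inl (h, b) => (g == h)%:R * sw (d g) a b
  | inr i, inr j => (i == j)%:R *+ 2
  | _, _ => 0
  end.

Lemma vsw_sym (k m : nat) (d : 'I_k -> bool) (u v : vertex k m) :
  vsw d u v = vsw d v u.
Proof.
case: u v => [[g a]|i] [[h b]|j] //=; last by rewrite eq_sym.
by rewrite eq_sym sw_sym; case: eqVneq => [->|]; rewrite ?mulr0n ?mul0r.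
Qed.

Lemma sum_vsw_inl (k m : nat) (d : 'I_k -> bool) (g : 'I_k) (a : 'I_11)
    (F : 'I_k * 'I_11 + 'I_m -> int) :
  \sum_w vsw d (inl (g, a)) w * F w = \sum_(c < 11) sw (d g) a c * F (inl (g, c)).
Proof.
rewrite big_vertex /= [X in _ + X]big1 ?addr0 => [|i _]; last by rewrite mul0r.
rewrite (bigD1 g) //= [X in _ + X]big1 ?addr0 => [|h hg].
  by apply: eq_bigr => c _; rewrite eqxx mul1r.
by apply: big1 => c _; rewrite eq_sym (negbTE hg) mulr0n !mul0r.
Qed.

Lemma sum_vsw_inr (k m : nat) (d : 'I_k -> bool) (i : 'I_m)
    (F : 'I_k * 'I_11 + 'I_m -> int) :
  \sum_w vsw d (inr i) w * F w = F (inr i) *+ 2.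
Proof.
rewrite big_vertex /= big1 ?add0r => [|h _]; last first.
  by apply: big1 => c _; rewrite mul0r.
rewrite (bigD1 i) //= eqxx big1 ?addr0 ?mulrnAl ?mul1r // => j ij.
by rewrite eq_sym (negbTE ij) mulr0n mul0rn mul0r.
Qed.

Lemma vsw_sqr (k m : nat) (d : 'I_k -> bool) (u v : 'I_k * 'I_11 + 'I_m) :
  \sum_w vsw d u w * vsw d w v = (u == v)%:R *+ 4.
Proof.
case: u => [[g a]|i].
  rewrite sum_vsw_inl; case: v => [[h b]|j] /=; last first.
    by rewrite big1 ?mul0rn // => c _; rewrite mulr0.
  under eq_bigr => c _ do rewrite mulrCA.
  rewrite -mulr_sumr (inj_eq inl_inj) xpair_eqE.
  by case: eqVneq => [_|_]; rewrite ?mulr0n ?mul0r ?mul0rn // mul1r sw_sqr.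
rewrite sum_vsw_inr; case: v => [[h b]|j] //=.
by rewrite -mulrnA (inj_eq inr_inj).
Qed.

(** Within a gadget, [J - 2I] sends the indicator of two of the four c's to twice that of the other
    two. Between gadgets there are only spine edges, reaching all four c's or none, and there
    [J - 2I] acts as [2I]. *)
Lemma vsw_vadj (k m : nat) (x x' : 'I_k -> bool) (u v : 'I_k * 'I_11 + 'I_m) :
  let d := fun g => x g (+) x' g in
  \sum_w vsw d u w * (vadj x w v)%:R = \sum_w (vadj x' u w)%:R * vsw d w v.
Proof.
move=> d; under [RHS]eq_bigr => w _ do rewrite vsw_sym mulrC.
case: u v => [[g a]|i] [[h b]|j]; rewrite ?sum_vsw_inl ?sum_vsw_inr /=.
- under [RHS]eq_bigr => c _ do rewrite mulrC sw_sym.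
  case: (eqVneq g h) => [->|gh].
    by apply: sw_label_adj.
  rewrite /d; transitivity
    (\sum_(c < 11) (label_adj false (x' g) (h <= g)%N (g <= h)%N a c)%:R
      * sw (d h) c b).
    by rewrite -(@sw_label_adj false (x g)) //.
  by [].
- by rewrite big1 ?mul0rn // => c _; rewrite mulr0.
- by rewrite mul0rn big1 // => c _; rewrite mulr0.
- by [].
Qed.

(** Nonzero entries off the diagonal occur only between c's of the same gadget, which have equal
    degrees. *)
Lemma vsw_vdegree (k m : nat) (d : 'I_k -> bool) (u v : vertex k m) :
  vsw d u v * (vdegree v)%:R = (vdegree u)%:R * vsw d u v.
Proof.
rewrite mulrC; have [->|neq] := eqVneq (vdegree u) (vdegree v) => //.
suff -> : vsw d u v = 0 by rewrite !mulr0.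
case: u v neq => [[g a]|i] [[h b]|j] //=.
case: (eqVneq g h) => [<-|_ _]; rewrite ?mulr0n ?mul0r // mul1r => neq.
rewrite /sw; case: ifP => [/and3P[_ a4 b4]|_].
  move: neq; rewrite /base_degree a4 b4.
  by rewrite (ltn_eqF (leq_trans a4 _)) // (ltn_eqF (leq_trans b4 _)) ?eqxx.
by case: (eqVneq (a : nat) b) neq => [->|_ _]; rewrite ?eqxx ?mulr0n ?mul0rn.
Qed.

(** * Transport to graphs on ['I_n] *)

Definition switch_graph (n k m : nat) (f : 'I_n -> vertex k m)
    (x : 'I_k -> bool) : sgraph n :=
  @SGraph n (relpre f (vadj x)) (fun u v => vadj_sym x (f u) (f v))
    (fun u => vadj_irrefl x (f u)).

Lemma big_bij (V : Type) (idx : V) (op : Monoid.com_law idx) (I J : finType)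
    (f : I -> J) (F : J -> V) :
  bijective f -> \big[op/idx]_i F (f i) = \big[op/idx]_j F j.
Proof. by move=> fbij; rewrite [RHS](reindex f) //; apply: onW_bij. Qed.

Lemma degree_switch_graph (n k m : nat) (f : 'I_n -> 'I_k * 'I_11 + 'I_m)
    (x : 'I_k -> bool) (u : 'I_n) :
  bijective f -> degree (switch_graph f x) u = vdegree (f u).
Proof.
move=> fbij; rewrite /degree -sum1dep_card big_mkcond /= -(sum_vadj x (f u)).
rewrite -(big_bij _ _ fbij) /=.
by apply: eq_bigr => v _; case: vadj.
Qed.

Lemma char_poly_switch_graph (R : numDomainType) (n k m : nat)
    (f : 'I_n -> 'I_k * 'I_11 + 'I_m) (x x' : 'I_k -> bool) (t : R) :
  bijective f ->
  char_poly (adjmx R (switch_graph f x) + t *: degmx R (switch_graph f x)) =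
  char_poly (adjmx R (switch_graph f x') + t *: degmx R (switch_graph f x')).
Proof.
move=> fbij.
(* One [Q], chosen without reference to [t], intertwines both the adjacency and the degree matrices,
   hence their combination for any [t]. *)
pose Q : 'M[R]_n := \matrix_(u, v) (vsw (fun g => x g (+) x' g) (f u) (f v))%:~R.
have QQ : Q *m Q = 4%:R%:M.
  apply/matrixP=> u v; rewrite !mxE; under eq_bigr do rewrite !mxE -intrM.
  rewrite -(rmorph_sum intr) (big_bij _ (fun w => vsw _ (f u) w * vsw _ w (f v)) fbij).
  rewrite vsw_sqr (bij_eq fbij); by case: eqP.
apply: (@char_poly_intertwine _ _ Q).
  have : \det (Q *m Q) != 0.
    by rewrite QQ det_scalar expf_neq0 // Num.Theory.pnatr_eq0.
  by rewrite det_mulmx mulf_eq0 negb_or => /andP[].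
have QD : Q *m degmx R (switch_graph f x) = degmx R (switch_graph f x') *m Q.
  apply/matrixP=> u v; rewrite mul_mx_diag mul_diag_mx !mxE.
  rewrite !(degree_switch_graph _ _ fbij).
  have := vsw_vdegree (fun g => x g (+) x' g) (f u) (f v).
  by move/(congr1 (intr : int -> R)); rewrite !rmorphM !rmorph_nat.
rewrite mulmxDr mulmxDl -scalemxAr -scalemxAl QD; congr (_ + _).
apply/matrixP=> u v; rewrite !mxE.
have /= := vsw_vadj x x' (f u) (f v).
rewrite -!(big_bij _ _ fbij) => /(congr1 (intr : int -> R)).
rewrite !rmorph_sum /= => QA.
transitivity (\sum_i (vsw (fun g => x g (+) x' g) (f u) (f i) *
    (vadj x (f i) (f v))%:R)%:~R : R).
  by apply: eq_bigr => w _; rewrite !mxE rmorphM rmorph_nat.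
by rewrite QA; apply: eq_bigr => w _; rewrite !mxE rmorphM rmorph_nat.
Qed.

Lemma clique4_switch_graph (n k m : nat) (f : 'I_n -> 'I_k * 'I_11 + 'I_m)
    (x : 'I_k -> bool) (g : 'I_k) : bijective f ->
  has_clique4_of_degree_sum (switch_graph f x) (16 + g) <-> x g = false.
Proof.
move=> fbij; split.
  move=> [u1 [u2 [u3 [u4 []]]]]; rewrite !(degree_switch_graph _ _ fbij).
  rewrite /clique4 /=; move: (f u1) (f u2) (f u3) (f u4).
  case=> [[g1 a1]|?] [[g2 a2]|?] [[g3 a3]|?] [[g4 a4]|?]; rewrite /= ?andbF //.
  move=> K d16. have /and4P[n1 n2 n3 n4] : [&& a1 != 10%N :> nat,
      a2 != 10%N :> nat, a3 != 10%N :> nat & a4 != 10%N :> nat].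
    apply: coarse_clique4; move: K; rewrite /clique4.
    by do 5!case/andP=> /label_adj_coarse -> /=; move=> /label_adj_coarse ->.
  (* Edges between different gadgets all use a spine vertex, so the clique stays in one gadget. *)
  have no_spine h h' y l l' (a b : 'I_11) : a != 10%N :> nat -> b != 10%N :> nat ->
      label_adj (h == h' :> 'I_k) y l l' a b -> h = h' /\ gadget y a b.
    move=> /negbTE a10 /negbTE b10; rewrite /label_adj /spine a10 b10 !andbF !orbF.
    by case/andP=> /eqP.
  move: K d16 => /and5P[/(no_spine _ _ _ _ _ _ _ n1 n2)[<- K12]].
  move=> /(no_spine _ _ _ _ _ _ _ n1 n3)[<- K13].
  move=> /(no_spine _ _ _ _ _ _ _ n1 n4)[<- K14].
  move=> /(no_spine _ _ _ _ _ _ _ n2 n3)[_ K23].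
  case/andP=> /(no_spine _ _ _ _ _ _ _ n2 n4)[_ K24].
  move=> /(no_spine _ _ _ _ _ _ _ n3 n4)[_ K34].
  have /gadget_clique4/and3P[/negbTE xg /eqP sum15 /eqP one] :
    clique4 (gadget (x g1)) a1 a2 a3 a4 by apply/and5P; split=> //; apply/andP.
  rewrite /= (negbTE n1) (negbTE n2) (negbTE n3) (negbTE n4) !mul0n !addn0 => d16.
  suff <- : g1 = g by [].
  apply: val_inj => /=; move: d16.
  have -> : forall b1 b2 b3 b4 c1 c2 c3 c4 e : nat,
    (b1 + c1 * e + (b2 + c2 * e) + (b3 + c3 * e) + (b4 + c4 * e) =
     b1 + b2 + b3 + b4 + (c1 + c2 + c3 + c4) * e)%N by move=> *; ring.
  (* The degree sum is [15 + g1.+1]: base degrees, plus the spine neighbours of the single c. *)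
  rewrite sum15 one mul1n => /eqP.
  by rewrite -[16%N]/(15 + 1)%N -addnA add1n eqn_add2l eqSS => /eqP.
move=> xg; case: fbij => f' fK f'K.
pose v a (a11 : (a < 11)%N) := f' (inl (g, Ordinal a11)).
(* These are c0, p1, p2, p3 of gadget [g]. *)
exists (v 0%N isT), (v 4%N isT), (v 5%N isT), (v 6%N isT).
rewrite !(degree_switch_graph _ _ (Bijective fK f'K)) /clique4 /= !f'K /=.
rewrite eqxx xg; split=> //; rewrite !mul0n mul1n /base_degree /=; ring.
Qed.

(** * The family indexed by bit vectors *)

Lemma card_vertex (n k : nat) : (11 * k <= n)%N ->
  #|{: 'I_k * 'I_11 + 'I_(n - 11 * k)}| = n.
Proof. by move=> kn; rewrite card_sum card_prod !card_ord mulnC subnKC. Qed.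

Theorem theorem6 (R : realType) :
  exists n0 : nat, forall n : nat, (n0 <= n)%N ->
    exists G : 'I_(2 ^ (n %/ 13)) -> sgraph n,
      (forall i j, i <> j -> ~ isomorphic (G i) (G j)) /\
      (forall (t : R) i j,
         cospectral (adjmx R (G i) + t *: degmx R (G i))
                    (adjmx R (G j) + t *: degmx R (G j))).
Proof.
(* Gadgets of 11 vertices fit for every [n], so the threshold can be 0; for [n < 13] the family is a
   single edgeless graph. *)
exists 0%N => n _; set k := (n %/ 13)%N.
have kn : (11 * k <= n)%N.
  by apply: leq_trans (leq_divM n 13); rewrite mulnC leq_mul2l orbT.
pose f (i : 'I_n) := enum_val (cast_ord (esym (card_vertex kn)) i).
have fbij : bijective f.
  apply: bij_comp; first exact: enum_val_bij.
  by exists (cast_ord (card_vertex kn)); [apply: cast_ordKV | apply: cast_ordK].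
have cardB : #|{ffun 'I_k -> bool}| = (2 ^ k)%N by rewrite card_ffun card_bool card_ord.
pose bits (i : 'I_(2 ^ k)) : {ffun 'I_k -> bool} := enum_val (cast_ord (esym cardB) i).
exists (fun i => switch_graph f (bits i)); split=> [i j ij iso|t i j a]; last first.
  by rewrite (char_poly_switch_graph _ (bits j)).
apply: ij; apply: (@cast_ord_inj _ _ (esym cardB)); apply: enum_val_inj.
apply/ffunP=> g; rewrite -/(bits i) -/(bits j).
(* The invariant passes both ways along [iso], so bit [g] is clear in one graph exactly when it is
   clear in the other. *)
have ij := isomorphic_has_clique4 (d := 16 + g) iso.
have ji := isomorphic_has_clique4 (d := 16 + g) (isomorphic_sym iso).
case xi: (bits i g).
  case xj: (bits j g) => //; move/(clique4_switch_graph _ _ fbij): xj => /ji.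
  by move/(clique4_switch_graph _ _ fbij); rewrite xi.
by move/(clique4_switch_graph _ _ fbij): xi => /ij/(clique4_switch_graph _ _ fbij) ->.
Qed.
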